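(* There exists a unique $G$-invariant Borel probability measure $\mu_1$ on the space $\mathfrak S$ of virtual permutations, where $G=S(\infty)\times S(\infty)$.
   Context: $S(n)$ is the group of permutations of $\{1,\dots,n\}$, identified with the stabilizer of $n+1$ in $S(n+1)$; $S(\infty)=\bigcup_n S(n)$; $G=S(\infty)\times S(\infty)$ and $G(n)=S(n)\times S(n)\subset G$. The canonical projection $p_{n,n+1}:S(n+1)\to S(n)$ removes $n+1$ from its cycle: for $x\in S(n+1)$ and $1\le i\le n$, $(p_{n,n+1}(x))(i)=x(i)$ if $x(i)\le n$, and $(p_{n,n+1}(x))(i)=x(n+1)$ if $x(i)=n+1$. It is equivariant with respect to the two-sided action of $S(n)$. The space of virtual permutations is the projective limit $\mathfrak S=\varprojlim S(n)$ along the canonical projections, i.e. the compact space of sequences $x=(x_n)_{n\ge1}$, $x_n\in S(n)$, with $p_{n,n+1}(x_{n+1})=x_n$ for all $n$, with the topology induced from the product of the finite discrete sets $S(n)$. $G$ acts on $\mathfrak S$ on the right by homeomorphisms: for $g=(g_1,g_2)\in G$ and $x=(x_n)$, $x\cdot g=y$ where $y_n=g_2^{-1}x_ng_1$ for all $n$ so large that $g\in G(n)$. *)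

(* Defs.v *)
From HB Require Import structures.
From mathcomp Require Import all_boot all_order all_algebra all_fingroup.
From mathcomp Require Import all_classical all_reals all_analysis.

Set Implicit Arguments.
Unset Strict Implicit.
Unset Printing Implicit Defensive.

Import Order.TTheory GRing.Theory Num.Theory.

Local Open Scope classical_set_scope.

(* Points are numbered from 0: {1, ..., n} is 'I_n and the group of its
   permutations is 'S_n.  A family indexed by n >= 1 is a family indexed by
   n : nat whose n-th term lives over 'I_n.+1.
   Products in 'S_n are read from left to right, (s * t)%g i = t (s i),
   whereas products in the infinite group below are compositions of functions,
   (g * h)%g i = g (h i). *)

Section CanonicalProjection.
Variables (n : nat) (s : 'S_n.+2).

Let wid : 'I_n.+1 -> 'I_n.+2 := widen_ord (leqnSn n.+1).

(* The argument of inord is always at most n: see canonical_projE. *)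
Definition canonical_proj_fun (i : 'I_n.+1) : 'I_n.+1 :=
  inord (if s (wid i) == ord_max then s ord_max else s (wid i)).

Lemma canonical_proj_funE i :
  canonical_proj_fun i = (if s (wid i) == ord_max then s ord_max else s (wid i))
  :> nat.
Proof.
rewrite inordK// ltn_neqAle -ltnS ltn_ord andbT.
case: ifPn => [/eqP si|//].
apply/eqP => smax; have /perm_inj : s ord_max = s (wid i) by rewrite si; apply/val_inj.
by move/(congr1 val) => /= e; have := ltn_ord i; rewrite -e ltnn.
Qed.

Lemma canonical_proj_fun_inj : injective canonical_proj_fun.
Proof.
have wmax i : wid i != ord_max by rewrite -val_eqE /= ltn_eqF.
move=> i j /(congr1 val) /=; rewrite !canonical_proj_funE.
case: ifPn => [/eqP si|ni]; case: ifPn => [/eqP sj|nj] /val_inj/= e.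
- have /perm_inj/(congr1 val) : s (wid i) = s (wid j) by rewrite si sj.
  by move=> /= ?; apply/val_inj.
- by move/perm_inj: e => /esym/eqP; rewrite (negbTE (wmax j)).
- by move/perm_inj: e => /eqP; rewrite (negbTE (wmax i)).
- by move/perm_inj: e => /(congr1 val) /= ?; apply/val_inj.
Qed.

Definition canonical_proj : 'S_n.+1 := perm canonical_proj_fun_inj.

Lemma canonical_projE i :
  canonical_proj i = (if s (wid i) == ord_max then s ord_max else s (wid i))
  :> nat.
Proof. by rewrite permE canonical_proj_funE. Qed.

End CanonicalProjection.

(* S(oo), realized as the group of permutations of nat that fix all but
   finitely many points. *)
Record Sinf := MkSinf {
  Sinf_fun :> nat -> nat ;
  Sinf_inv_fun : nat -> nat ;
  Sinf_funK : cancel Sinf_fun Sinf_inv_fun ;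
  Sinf_inv_funK : cancel Sinf_inv_fun Sinf_fun ;
  Sinf_finite : exists n, forall i, n <= i -> Sinf_fun i = i }.

HB.instance Definition _ := gen_eqMixin Sinf.
HB.instance Definition _ := gen_choiceMixin Sinf.

Lemma Sinf_eq (g h : Sinf) : g =1 h -> g = h.
Proof.
case: g h => [f f' fK f'K ff] [k k' kK k'K kf] /= /funext efk.
move: fK f'K ff; rewrite efk => fK f'K ff {f efk}.
have e : f' = k' by apply/funext => i; rewrite -{1}(k'K i) fK.
move: fK f'K; rewrite e => fK f'K.
by congr MkSinf; exact: Prop_irrelevance.
Qed.

Section SinfGroup.

Lemma Sinf_one_finite : exists n : nat, forall i, n <= i -> idfun i = i.
Proof. by exists 0. Qed.

Definition Sinf_one : Sinf :=
  @MkSinf idfun idfun (fun=> erefl) (fun=> erefl) Sinf_one_finite.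

Lemma Sinf_inv_finite (g : Sinf) :
  exists n, forall i, n <= i -> Sinf_inv_fun g i = i.
Proof.
have [n gn] := Sinf_finite g; exists n => i /gn gi.
by rewrite -{1}gi Sinf_funK.
Qed.

Definition Sinf_inv (g : Sinf) : Sinf :=
  MkSinf (@Sinf_inv_funK g) (@Sinf_funK g) (Sinf_inv_finite g).

Lemma Sinf_mul_finite (g h : Sinf) :
  exists n, forall i, n <= i -> (g \o h) i = i.
Proof.
have [n gn] := Sinf_finite g; have [m hm] := Sinf_finite h.
exists (maxn n m) => i; rewrite geq_max => /andP[ni mi].
by rewrite /= hm// gn.
Qed.

Definition Sinf_mul (g h : Sinf) : Sinf :=
  MkSinf (can_comp (@Sinf_funK g) (@Sinf_funK h))
         (can_comp (@Sinf_inv_funK h) (@Sinf_inv_funK g))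
         (Sinf_mul_finite g h).

Lemma Sinf_mulA : associative Sinf_mul.
Proof. by move=> g h k; exact: Sinf_eq. Qed.

Lemma Sinf_mul1g : left_id Sinf_one Sinf_mul.
Proof. by move=> g; exact: Sinf_eq. Qed.

Lemma Sinf_mulg1 : right_id Sinf_one Sinf_mul.
Proof. by move=> g; exact: Sinf_eq. Qed.

Lemma Sinf_mulVg : left_inverse Sinf_one Sinf_inv Sinf_mul.
Proof. by move=> g; apply: Sinf_eq => i /=; exact: Sinf_funK. Qed.

Lemma Sinf_mulgV : right_inverse Sinf_one Sinf_inv Sinf_mul.
Proof. by move=> g; apply: Sinf_eq => i /=; exact: Sinf_inv_funK. Qed.

End SinfGroup.

HB.instance Definition _ := isGroup.Build Sinf
  Sinf_mulA Sinf_mul1g Sinf_mulg1 Sinf_mulVg Sinf_mulgV.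

(* g belongs to the subgroup S(n) of S(oo) *)
Definition in_S (n : nat) (g : Sinf) : Prop := forall i, n <= i -> g i = i.

Lemma in_S_ltn n g i : in_S n g -> i < n -> g i < n.
Proof.
move=> gn ilt; rewrite ltnNge; apply/negP => ngi.
have : g (g i) = g i by exact: gn.
by move/(can_inj (@Sinf_funK g)) => e; move: ngi; rewrite e leqNgt ilt.
Qed.

Lemma in_SV n g : in_S n g -> in_S n g^-1%g.
Proof. by move=> gn i /gn gi; rewrite /= -{1}gi Sinf_funK. Qed.

Lemma in_SW n m g : n <= m -> in_S n g -> in_S m g.
Proof. by move=> nm gn i mi; apply: gn; exact: leq_trans mi. Qed.

(* The permutation of 'I_n.+1 induced by an element g of S(n.+1); junk when
   g is not in S(n.+1). *)
Definition Sinf_perm (n : nat) (g : Sinf) : 'S_n.+1 :=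
  insubd (1%g : 'S_n.+1) [ffun i : 'I_n.+1 => inord (g i)].

Lemma Sinf_permE n g i : in_S n.+1 g -> Sinf_perm n g i = g i :> nat.
Proof.
move=> gn; have gK (j : 'I_n.+1) : (inord (g j) : 'I_n.+1) = g j :> nat.
  by rewrite inordK// in_S_ltn.
rewrite /Sinf_perm -pvalE [pval _]insubdK; first by rewrite ffunE gK.
apply/injectiveP => j k; rewrite !ffunE => /(congr1 val) /=.
by rewrite !gK => /(can_inj (@Sinf_funK g)) ?; apply/val_inj.
Qed.

Definition G : Type := (Sinf * Sinf)%type.

Definition in_G (n : nat) (g : G) : Prop := in_S n g.1 /\ in_S n g.2.

Lemma in_G_ex (g : G) : exists n, in_G n g.
Proof.
have [n gn] := Sinf_finite g.1; have [m gm] := Sinf_finite g.2.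
by exists (maxn n m); split; [apply: in_SW gn | apply: in_SW gm];
  rewrite ?leq_maxl ?leq_maxr.
Qed.

Definition vperm_seq : Type :=
  prod_topology (fun n : nat => discrete_topology 'S_n.+1).

HB.instance Definition _ := Topological.on vperm_seq.

Definition coherent : set vperm_seq :=
  [set x : vperm_seq | forall n, @canonical_proj n (x n.+1) = x n].

(* set_type carries the topology induced from the product topology. *)
Definition vperm : Type := set_type coherent.

HB.instance Definition _ := Topological.copy vperm (set_type coherent).

Definition vperm_val (x : vperm) (n : nat) : 'S_n.+1 := set_val x n.

Lemma vperm_valP (x : vperm) n :
  canonical_proj (vperm_val x n.+1) = vperm_val x n.
Proof. exact: (set_valP x). Qed.

Lemma vperm_eq (x y : vperm) : (forall n, vperm_val x n = vperm_val y n) -> x = y.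
Proof. by move=> exy; apply: val_inj; exact/functional_extensionality_dep. Qed.

(* By coherence, a virtual permutation is determined by any of its tails. *)
Lemma vperm_eq_tail (x y : vperm) N :
  (forall n, N <= n -> vperm_val x n = vperm_val y n) -> x = y.
Proof.
elim: N => [|N IH] exy; first by apply: vperm_eq => n; exact: exy.
by apply: IH => n Nn; rewrite -(vperm_valP x) -(vperm_valP y) exy.
Qed.

Lemma canonical_proj1 n : canonical_proj (1 : 'S_n.+2)%g = 1%g.
Proof.
apply/permP => i; apply/val_inj; rewrite /= canonical_projE !perm1.
by rewrite -val_eqE /= ltn_eqF.
Qed.

Lemma coherent1 : coherent (fun=> 1%g).
Proof. by move=> n; exact: canonical_proj1. Qed.

HB.instance Definition _ :=
  isPointed.Build vperm (SigSub (mem_set coherent1)).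

(* The composition g_2^-1 o x_n o g_1, written in the left-to-right order of
   'S_n.+1; meaningful only when g is in G(n.+1). *)
Definition two_sided (g : G) (x : vperm) : vperm_seq :=
  fun n => (Sinf_perm n g.1 * vperm_val x n * (Sinf_perm n g.2)^-1)%g.

Lemma Sinf_permV n g : in_S n.+1 g -> ((Sinf_perm n g)^-1)%g = Sinf_perm n g^-1%g.
Proof.
move=> gn; apply/permP => i; apply: (@perm_inj _ (Sinf_perm n g)).
rewrite permKV; apply/val_inj => /=; rewrite !Sinf_permE//=; last exact: in_SV.
by rewrite Sinf_inv_funK.
Qed.

Lemma two_sided_coherent g x n :
  in_G n.+1 g -> canonical_proj (two_sided g x n.+1) = two_sided g x n.
Proof.
move=> [g1n g2n]; have gg1 := in_SW (leqnSn _) g1n.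
have gg2 := in_SW (leqnSn _) g2n.
rewrite /two_sided -(vperm_valP x n) !Sinf_permV//.
set w := widen_ord (leqnSn n.+1).
have hw h (j : 'I_n.+1) : in_S n.+1 h ->
    Sinf_perm n.+1 h (w j) = w (Sinf_perm n h j).
  move=> hn; apply/val_inj; rewrite /= !Sinf_permE//.
  exact: in_SW (leqnSn _) hn.
have hmax h : in_S n.+1 h -> Sinf_perm n.+1 h ord_max = ord_max.
  move=> hn; apply/val_inj; rewrite /= Sinf_permE/= ?hn//.
  exact: in_SW (leqnSn _) hn.
apply/permP => i; apply/val_inj; rewrite /= canonical_projE !permM hw// hmax//.
rewrite -/w.
set X := vperm_val x n.+1; set j := Sinf_perm n g.1 i.
have hinj h (k : 'I_n.+2) : in_S n.+1 h ->
    (Sinf_perm n.+1 h k == ord_max) = (k == ord_max).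
  by move=> hn; rewrite -{1}(hmax h hn) (inj_eq perm_inj).
have g2V := in_SV g2n.
rewrite hinj// [in RHS]Sinf_permE// canonical_projE -/w.
by case: ifPn => _; rewrite Sinf_permE//; exact: in_SV.
Qed.

(* Replaces each term by the projection of its successor; this leaves the
   coherent tail of a sequence unchanged. *)
Definition shift_proj (z : vperm_seq) : vperm_seq :=
  fun n => @canonical_proj n (z n.+1).

Lemma iter_shift_proj N (z : vperm_seq) :
  (forall n, N <= n -> @canonical_proj n (z n.+1) = z n) ->
  coherent (iter N shift_proj z) /\
  forall n, N <= n -> iter N shift_proj z n = z n.
Proof.
elim: N z => [|N IH] z zN; first by split=> // n; exact: zN.
have sz n : N < n -> shift_proj z n = z n by move=> /zN.
have [|cz ez] := IH (shift_proj z).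
  by move=> n Nn; rewrite sz.
rewrite iterSr; split=> // n Nn; rewrite ez ?sz//; exact: ltnW.
Qed.

Lemma vact_subproof (g : G) (x : vperm) :
  exists y : vperm, forall n, in_G n.+1 g -> vperm_val y n = two_sided g x n.
Proof.
have gW n m : n <= m -> in_G n g -> in_G m g.
  by move=> nm [? ?]; split; exact: in_SW nm _.
have [N0 gN0] := in_G_ex g.
have [N gN Nmin] : exists2 N, in_G N.+1 g & forall n, in_G n.+1 g -> N <= n.
  have ex : exists n, `[< in_G n.+1 g >].
    by exists N0; apply/asboolP; exact: gW gN0.
  case: (ex_minnP ex) => N /asboolP gN Nmin; exists N => // n gn.
  by apply: Nmin; apply/asboolP.
have [|cy ey] := @iter_shift_proj N (two_sided g x).
  by move=> n Nn; apply: two_sided_coherent; exact: gW gN.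
exists (SigSub (mem_set cy)) => n /Nmin Nn.
by rewrite /vperm_val set_valE /= ey.
Qed.

(* The virtual permutation x . g: by vactE and vact_unique it is the only one
   whose terms are g_2^-1 o x_n o g_1 for all large n. *)
Definition vact (x : vperm) (g : G) : vperm := sval (cid (vact_subproof g x)).

Lemma vactE x g n : in_G n.+1 g ->
  vperm_val (vact x g) n =
  (Sinf_perm n g.1 * vperm_val x n * (Sinf_perm n g.2)^-1)%g.
Proof. by rewrite /vact; case: cid => y /= ey /ey. Qed.

Lemma vact_unique x g y N :
  (forall n, N <= n -> in_G n.+1 g -> vperm_val y n = two_sided g x n) ->
  y = vact x g.
Proof.
move=> ey; have [M [gM1 gM2]] := in_G_ex g.
apply: (@vperm_eq_tail _ _ (maxn N M)) => n; rewrite geq_max => /andP[Nn Mn].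
have gn : in_G n.+1 g by split; [move: gM1|move: gM2]; apply: in_SW; rewrite leqW.
by rewrite vactE// ey.
Qed.

Lemma vact1 x : vact x 1%g = x.
Proof.
apply/esym/(@vact_unique _ _ _ 0) => n _ _; apply/permP => i.
rewrite /two_sided.
have -> : Sinf_perm n 1%g = 1%g.
  by apply/permP => j; apply/val_inj; rewrite /= Sinf_permE// perm1.
by rewrite mul1g invg1 mulg1.
Qed.

Lemma Sinf_permM n g h : in_S n.+1 g -> in_S n.+1 h ->
  Sinf_perm n (g * h)%g = (Sinf_perm n h * Sinf_perm n g)%g.
Proof.
move=> gn hn; apply/permP => i; apply/val_inj; rewrite /= permM !Sinf_permE//.
by move=> j jn /=; rewrite hn ?gn.
Qed.

Lemma vactM x (g h : G) : vact x (g * h)%g = vact (vact x g) h.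
Proof.
have [N [g1 g2]] := in_G_ex g; have [M [h1 h2]] := in_G_ex h.
apply/esym/(@vact_unique _ _ _ (maxn N M)) => n; rewrite geq_max => /andP[Nn Mn] _.
have [gn1 gn2] : in_G n.+1 g by split; [move: g1|move: g2]; apply: in_SW; rewrite leqW.
have [hn1 hn2] : in_G n.+1 h by split; [move: h1|move: h2]; apply: in_SW; rewrite leqW.
rewrite vactE// vactE// /two_sided Sinf_permM// [in RHS]Sinf_permM//.
by rewrite invMg !mulgA.
Qed.

Definition vperm_borel : Type := g_sigma_algebraType (@open vperm).

HB.instance Definition _ :=
  Measurable.copy vperm_borel (g_sigma_algebraType (@open vperm)).

Definition G_invariant (R : realType) (mu : probability vperm_borel R) : Prop :=
  forall (g : G) (A : set vperm_borel), measurable A ->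
    mu ((fun x : vperm_borel => vact x g : vperm_borel) @^-1` A) = mu A.

(* Main.v *)
Require Import Defs.
From HB Require Import structures.
From mathcomp Require Import all_boot all_order all_algebra all_fingroup.
From mathcomp Require Import all_classical all_reals all_analysis.

(** Everything is controlled by the sets [x | x_n = s], called cylinders below.

    The cylinders of level at least N, for any fixed N, form a pi-system (up to
    the empty set) which generates the Borel sigma-algebra: they are a
    countable base of the topology, because by coherence the single term x_n
    determines all earlier terms.  A Borel probability measure is therefore
    determined by its values on them ([eq_probability_cylinder]).

    Since S(n+1) acts transitively on itself by translations, an element of
    G(n+1) carries any cylinder of level n to any other one of the same level.
    There are (n+1)! of them and they partition the space, so an invariant
    probability gives each of them the mass 1/(n+1)! ([G_invariant_cylinder]).
    This is uniqueness.  Conversely, a probability with these values is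
    invariant: an element g of G belongs to G(n+1) for all large n, and then
    permutes the cylinders of level n, so that the measure and its translate by
    g agree on all cylinders of large level ([cylinder_G_invariant]).

    It remains to construct one probability whose projections on all the S(n)
    are uniform.  The fibre of S(n+2) -> S(n+1) over s has n+2 elements, one
    for each possible image of the new point ([insert_max]).  Listing them in
    this order, level after level, numbers S(n+1) by the integers below (n+1)!
    in such a way that the canonical projection becomes the Euclidean division
    by n+2 ([fact_decode]).  Integers related by these divisions are the
    successive truncations of a real number u of [0, 1[ in the factorial number
    system, that is, the integer parts of u (n+1)!.  Thus u defines a virtual
    permutation, the event x_n = s says that u lies in an interval of length
    1/(n+1)!, and the image of the Lebesgue measure on [0, 1[ is the measure
    sought ([uniform_vperm_cylinder]). *)

Set Implicit Arguments.
Unset Strict Implicit.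
Unset Printing Implicit Defensive.

Import Order.TTheory GRing.Theory Num.Theory.

Local Open Scope classical_set_scope.

(** * Cylinders and the Borel sigma-algebra *)

Definition cylinder n (s : 'S_n.+1) : set vperm_borel :=
  [set x | vperm_val x n = s].

Lemma vperm_val_le (x y : vperm) m n : m <= n ->
  vperm_val x n = vperm_val y n -> vperm_val x m = vperm_val y m.
Proof.
move=> /subnK <-; elim: (n - m) => [//|d IH] e.
by apply: IH; rewrite -(vperm_valP x) -(vperm_valP y) e.
Qed.

Lemma vperm_val_continuous n :
  continuous (fun x : vperm => vperm_val x n : discrete_topology 'S_n.+1).
Proof.
move=> x; apply: (@continuous_comp vperm vperm_seq _ set_val (proj n)).
  exact: initial_continuous.
exact: proj_continuous.
Qed.

Lemma cylinder_open n (s : 'S_n.+1) : @open vperm (cylinder s).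
Proof.
have /continuousP vc := @vperm_val_continuous n.
by apply: (vc [set s]); exact: discrete_open.
Qed.

Lemma cylinder_measurable n (s : 'S_n.+1) : measurable (cylinder s).
Proof. by apply: sub_sigma_algebra; exact: cylinder_open. Qed.

(** The sets of sequences with prescribed first terms are a base of
    neighbourhoods: the filter that they generate at x converges to x, because
    a supremum topology makes a filter converge as soon as each of the
    topologies does. *)
Lemma nbhs_vperm_seq (x : vperm_seq) (B : set vperm_seq) : nbhs x B ->
  exists n, [set z : vperm_seq | forall m, m <= n -> z m = x m] `<=` B.
Proof.
pose F : set_system vperm_seq := filter_from [set: nat]
  (fun n => [set z : vperm_seq | forall m, m <= n -> z m = x m]).
have FF : Filter F.
  apply: filter_from_filter; first by exists 0.
  move=> i j _ _; exists (maxn i j) => // z zx; split=> m mi; apply: zx.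
    by rewrite leq_max mi.
  by rewrite leq_max mi orbT.
have Fx : F --> x.
  apply/cvg_sup => n A /= [_ [[V _ <-] Vx] VA].
  by exists n => // z zx; apply: VA; rewrite /= /proj/= zx.
by move=> /Fx[n _ nB]; exists n.
Qed.

(** The level can be taken as large as wished; this freedom is what later lets
    each g in G be treated at levels where it acts on cylinders. *)
Lemma nbhs_cylinder N (x : vperm) (U : set vperm) : nbhs x U ->
  exists2 n, N <= n & cylinder (vperm_val x n) `<=` U.
Proof.
move=> [_ [[V oV <-] Vx] VU].
have [n nV] := nbhs_vperm_seq (open_nbhs_nbhs (conj oV Vx)).
exists (maxn N n) => [|y yx]; first exact: leq_maxl.
apply/VU/nV => m mn.
by apply: (vperm_val_le (n := maxn N n)) yx; rewrite leq_max mn orbT.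
Qed.

(** The empty set makes the family stable under intersection, since two
    cylinders are either nested or disjoint. *)
Definition cylinders N : set (set vperm_borel) :=
  [set C | C = set0 \/ exists2 n, N <= n & exists s : 'S_n.+1, C = cylinder s].

Lemma cylindersI N : setI_closed (cylinders N).
Proof.
have key m n (s : 'S_m.+1) (t : 'S_n.+1) : N <= n -> m <= n ->
    cylinders N (cylinder s `&` cylinder t).
  move=> Nn mn.
  have [[x [sx tx]]|st] := pselect (exists x, (cylinder s `&` cylinder t) x).
    right; exists n => //; exists t; apply/seteqP; split=> [y []//|y ty].
    by split=> //; rewrite /cylinder/= -sx; apply: vperm_val_le mn _; rewrite ty.
  by left; apply/seteqP; split=> // y sty; apply: st; exists y.
move=> _ _ [->|[m Nm [s ->]]] [->|[n Nn [t ->]]];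
  rewrite ?set0I ?setI0; do 1?by left.
by case: (leqP m n) => [/key|/ltnW/key]; [|rewrite setIC]; exact.
Qed.

(** An open set is the union of the cylinders that it contains, and there are
    only countably many cylinders. *)
Lemma borel_cylinders N :
  @measurable _ vperm_borel = <<s cylinders N >>.
Proof.
apply/seteqP; split; last first.
  apply: smallest_sub; first exact: sigma_algebra_measurable.
  move=> _ [->|[n _ [s ->]]]; first exact: measurable0.
  exact: cylinder_measurable.
apply: smallest_sub; first exact: smallest_sigma_algebra.
move=> U oU.
pose T := g_sigma_algebraType (cylinders N).
pose P := [set p : {n & 'S_n.+1} | N <= tag p /\ cylinder (tagged p) `<=` U].
have -> : U = \bigcup_(p in P) cylinder (tagged p).
  apply/seteqP; split=> [x Ux|x [p [_ pU] /pU//]].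
  have [n Nn nU] := nbhs_cylinder N (open_nbhs_nbhs (conj oU Ux)).
  by exists (Tagged (fun n => 'S_n.+1) (vperm_val x n)).
rewrite bigcup_mkcond.
apply: (@countable_bigcupT_measurable _ T {n & 'S_n.+1}) => [|p].
  exact: countableP.
case: ifPn => [|_]; last exact: (@measurable0 _ T).
rewrite inE => -[Np _]; apply: sub_sigma_algebra; right.
by exists (tag p) => //; exists (tagged p).
Qed.

Lemma bigcup_cylinder n : \bigcup_(s : 'S_n.+1) cylinder s = setT.
Proof. by apply/seteqP; split=> // x _; exists (vperm_val x n). Qed.

Lemma trivIset_cylinder n : trivIset setT (@cylinder n).
Proof.
apply/trivIsetP => s t _ _ /eqP st.
by apply/seteqP; split=> // x [/= xs xt]; apply: st; rewrite -xs.
Qed.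

(** * Probability measures are determined by their values on cylinders *)

Lemma eq_probability_cylinder (R : realType) N
    (mu nu : probability vperm_borel R) :
  (forall n, N <= n -> forall s : 'S_n.+1,
    mu (cylinder s) = nu (cylinder s)) ->
  forall A : set vperm_borel, measurable A -> mu A = nu A.
Proof.
move=> mn A mA.
(* The uniqueness theorem wants a sequence of generators that covers the space;
   past the end of the enumeration, nth repeats the cylinder of the identity. *)
pose g k : set vperm_borel := cylinder (nth (1%g : 'S_N.+1) (enum 'S_N.+1) k).
apply: (measure_unique (cylinders N) g (borel_cylinders N)) => //.
- exact: cylindersI.
- by move=> k; right; exists N => //; eexists.
- apply/seteqP; split=> // x _; exists (index (vperm_val x N) (enum 'S_N.+1)) => //.
  by rewrite /g /cylinder/= nth_index// mem_enum.
- by move=> B [->|[n Nn [s ->]]]; [rewrite !measure0 | exact: mn].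
- by move=> k; rewrite ltey_eq fin_num_measure//; exact: cylinder_measurable.
Qed.

(** The cylinders of level n partition the space into (n+1)! sets. *)
Lemma probability_cylinder_const (R : realType)
    (P : probability vperm_borel R) n :
  (forall s t : 'S_n.+1, P (cylinder s) = P (cylinder t)) ->
  forall s : 'S_n.+1, P (cylinder s) = ((n.+1)`!%:R^-1)%:E.
Proof.
move=> PC s.
have Pfin : P (cylinder s) \is a fin_num.
  by rewrite fin_num_measure//; exact: cylinder_measurable.
have : P setT = (P (cylinder s) *+ (n.+1)`!)%E.
  rewrite -(bigcup_cylinder n) measure_fin_bigcup//=; last 2 first.
  - exact: trivIset_cylinder.
  - by move=> t _; exact: cylinder_measurable.
  have -> : [set: 'S_n.+1] = [set` enum 'S_n.+1].
    by apply/seteqP; split=> // t _; rewrite /= mem_enum.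
  rewrite -fsbig_seq ?enum_uniq//=.
  rewrite (eq_bigr (fun=> P (cylinder s))); last by move=> t _; exact: PC.
  by rewrite big_const_seq count_predT iter_addr_0 -cardE card_Sn.
rewrite probability_setT -(fineK Pfin) -EFin_natmul => -[e].
congr EFin; rewrite -[RHS]mul1r; apply: (canRL (mulfK _)).
  by rewrite pnatr_eq0 -lt0n fact_gt0.
by rewrite mulr_natr.
Qed.

(** * Action on cylinders and invariance *)

Definition perm_ext n (t : 'S_n) (i : nat) : nat :=
  oapp (fun j : 'I_n => val (t j)) i (insub i).

Lemma perm_extE n (t : 'S_n) (i : 'I_n) : perm_ext t i = t i.
Proof. by rewrite /perm_ext valK. Qed.

Lemma perm_ext_ge n (t : 'S_n) i : n <= i -> perm_ext t i = i.
Proof. by move=> ni; rewrite /perm_ext insubF//= ltnNge ni. Qed.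

Lemma perm_extK n (t u : 'S_n) :
  cancel t u -> cancel (perm_ext t) (perm_ext u).
Proof.
move=> tK i; have [ni|ni] := leqP n i; first by rewrite !perm_ext_ge.
by rewrite -[i]/(val (Ordinal ni)) !perm_extE tK.
Qed.

Definition Sinf_of_perm n (s : 'S_n) : Sinf :=
  MkSinf (perm_extK (permK s)) (perm_extK (permKV s))
    (ex_intro _ n (@perm_ext_ge n s)).

Lemma Sinf_of_perm_in_S n (s : 'S_n) : in_S n (Sinf_of_perm s).
Proof. exact: perm_ext_ge. Qed.

Lemma Sinf_of_permK n (s : 'S_n.+1) : Sinf_perm n (Sinf_of_perm s) = s.
Proof.
apply/permP => i; apply/val_inj.
by rewrite /= Sinf_permE; [exact: perm_extE | exact: Sinf_of_perm_in_S].
Qed.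

Lemma preimage_vact_cylinder (g : G) n (s : 'S_n.+1) : in_G n.+1 g ->
  (fun x : vperm_borel => vact x g : vperm_borel) @^-1` cylinder s =
  cylinder ((Sinf_perm n g.1)^-1 * s * Sinf_perm n g.2)%g.
Proof.
move=> gn; apply/seteqP; split=> x; rewrite /cylinder/= vactE//.
  by move=> <-; rewrite !mulgA mulVg mul1g mulgKV.
by move=> ->; rewrite !mulgA mulgV mul1g mulgK.
Qed.

Lemma in_G_leq (g : G) : exists N, forall n, N <= n -> in_G n.+1 g.
Proof.
have [N [g1 g2]] := in_G_ex g; exists N => n Nn.
by split; [move: g1|move: g2]; apply: in_SW; rewrite leqW.
Qed.

(** The levels at which g does not act on cylinders are avoided by generating
    the Borel sets from the cylinders of large level only. *)
Lemma vact_measurable (g : G) :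
  measurable_fun setT (fun x : vperm_borel => vact x g : vperm_borel).
Proof.
have [N gN] := in_G_leq g.
apply: (measurability (cylinders N)); first exact: borel_cylinders.
move=> _ [_ [->|[n Nn [s ->]]] <-]; rewrite setTI ?preimage_set0//.
rewrite preimage_vact_cylinder; last exact: gN.
exact: cylinder_measurable.
Qed.

(** Left translations of S(n+1) move any cylinder of level n to any other. *)
Lemma G_invariant_cylinder (R : realType) (P : probability vperm_borel R) n
    (s : 'S_n.+1) :
  G_invariant P -> P (cylinder s) = ((n.+1)`!%:R^-1)%:E.
Proof.
move=> Pinv; apply: probability_cylinder_const => {}s t.
pose g : G := (Sinf_of_perm (s * t^-1)%g, 1%g).
have gn : in_G n.+1 g by split=> //; exact: Sinf_of_perm_in_S.
rewrite -(Pinv g _ (cylinder_measurable s)) preimage_vact_cylinder//=.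
rewrite Sinf_of_permK invMg invgK mulgKV; congr (P (cylinder _)).
by apply/permP => i; apply/val_inj; rewrite /= permM Sinf_permE.
Qed.

(** The image of P under g has the same values as P on the cylinders of every
    level n with g in G(n+1), because g permutes these cylinders. *)
Lemma cylinder_G_invariant (R : realType) (P : probability vperm_borel R) :
  (forall n (s : 'S_n.+1), P (cylinder s) = ((n.+1)`!%:R^-1)%:E) ->
  G_invariant P.
Proof.
move=> PE g A mA; have [N gN] := in_G_leq g.
pose vg : {mfun vperm_borel >-> vperm_borel} :=
  mfun_Sub (mem_set (vact_measurable g)).
apply: (@eq_probability_cylinder R N (distribution P vg)) => // n Nn s.
transitivity
  (P ((fun x : vperm_borel => vact x g : vperm_borel) @^-1` cylinder s)).
  by [].
by rewrite preimage_vact_cylinder ?PE//; exact: gN.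
Qed.

(** * Numbering of the permutations along the projections *)

(** The permutation obtained by inserting the new point just before i in its
    cycle of s, or as a fixed point when i is the new point itself. *)
Definition insert_max n (s : 'S_n.+1) (i : 'I_n.+2) : 'S_n.+2 :=
  (lift_perm ord_max ord_max s * tperm ord_max i)%g.

Lemma insert_max_max n (s : 'S_n.+1) i : insert_max s i ord_max = i.
Proof. by rewrite permM lift_perm_id tpermL. Qed.

Lemma canonical_proj_insert_max n (s : 'S_n.+1) i :
  canonical_proj (insert_max s i) = s.
Proof.
apply/permP => j; apply/val_inj; rewrite /= canonical_projE insert_max_max.
have -> : widen_ord (leqnSn n.+1) j = lift ord_max j.
  by apply/val_inj; rewrite [RHS]lift_max.
rewrite permM lift_perm_lift; case: tpermP => [/eqP|<-|/eqP _ /eqP ni].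
- by rewrite eq_sym (negbTE (neq_lift _ _)).
- by rewrite eqxx lift_max.
- by rewrite eq_sym (negbTE (neq_lift _ _)) lift_max.
Qed.

(** The permutation number k, built from the digits of k in the factorial
    number system: the last digit is the image of the largest point, and the
    others give the projection. *)
Fixpoint fact_decode n k : 'S_n.+1 :=
  if n is m.+1 then insert_max (fact_decode m (k %/ m.+2)) (inord (k %% m.+2))
  else 1%g.

Lemma canonical_proj_fact_decode n k :
  canonical_proj (fact_decode n.+1 k) = fact_decode n (k %/ n.+2).
Proof. exact: canonical_proj_insert_max. Qed.

(** The projection recovers the quotient of k by n+2, and the image of the
    largest point recovers the remainder. *)
Lemma fact_decode_inj n k l : k < (n.+1)`! -> l < (n.+1)`! ->
  fact_decode n k = fact_decode n l -> k = l.
Proof.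
elim: n k l => [[|k] [|l]//|n IH k l kn ln e].
have ediv : k %/ n.+2 = l %/ n.+2.
  apply: IH; rewrite ?ltn_divLR// 1?mulnC -?factS//.
  by rewrite -!canonical_proj_fact_decode e.
have emod : k %% n.+2 = l %% n.+2.
  have /(congr1 (fun s : 'S_n.+2 => val (s ord_max))) := e.
  by rewrite /= !insert_max_max !inordK ?ltn_pmod.
by rewrite (divn_eq k n.+2) ediv emod -divn_eq.
Qed.

Lemma fact_decode_surj n (s : 'S_n.+1) :
  exists2 k, k < (n.+1)`! & fact_decode n k = s.
Proof.
pose f (k : 'I_((n.+1)`!)) := fact_decode n k.
have f_inj : injective f.
  by move=> k l /fact_decode_inj e; apply/val_inj/e.
have [|g _ gK] := inj_card_bij f_inj; first by rewrite card_Sn card_ord.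
by exists (g s) => //; exact: gK.
Qed.

(** Dropping the last digit of a truncation of x gives the previous truncation;
    this is where coherence of the sequence built from x comes from. *)
Lemma truncn_divn (R : archiRealDomainType) (x : R) d : 0 < d ->
  Num.truncn (x * d%:R)%R %/ d = Num.truncn x.
Proof.
move=> d0; have d0R : (0 < d%:R :> R)%R by rewrite ltr0n.
have [x0|x0] := leP 0%R x; last first.
  by rewrite !truncn_floor !leNgt pmulr_llt0// x0 div0n.
apply/esym/truncn_def; set m := Num.truncn _.
have /andP[ml mr] : (m%:R <= x * d%:R < m.+1%:R)%R.
  by apply: truncn_itv; rewrite mulr_ge0// ltW.
apply/andP; split; rewrite -(ler_pM2r d0R, ltr_pM2r d0R) -natrM.
  by apply: le_trans ml; rewrite ler_nat leq_divM.
by apply: lt_le_trans mr _; rewrite ler_nat -ltn_divLR.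
Qed.

(** * The uniform virtual permutation *)

Section UniformVirtualPermutation.
Variable R : realType.

Let scaled_trunc n (u : R) : nat := Num.truncn (u * ((n.+1)`!)%:R)%R.

Lemma vperm_of_real_coherent (u : R) :
  coherent (fun n => fact_decode n (scaled_trunc n u)).
Proof.
move=> n; rewrite /= canonical_proj_fact_decode /scaled_trunc.
by rewrite factS mulnC natrM mulrA truncn_divn.
Qed.

Definition vperm_of_real (u : measurableTypeR R) : vperm_borel :=
  SigSub (mem_set (vperm_of_real_coherent u)).

Lemma scaled_trunc_measurable n k :
  measurable [set u | scaled_trunc n u = k].
Proof.
have mle m : measurable [set u | scaled_trunc n u <= m].
  rewrite (_ : mkset _ = `]-oo, (m.+1%:R / (n.+1)`!%:R : R)%R[%classic).
    exact: measurable_itv.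
  apply/seteqP; split=> u;
    by rewrite /= in_itv/= truncn_le_nat ltr_pdivlMr// ltr0n fact_gt0.
rewrite (_ : mkset _ = [set u | scaled_trunc n u <= k] `\`
    \bigcup_(m in `I_k) [set u | scaled_trunc n u <= m]).
  by apply: measurableD => //; apply: bigcup_measurable.
apply/seteqP; split=> u /=.
  by move=> uk; split=> [|[m /= mk]]; rewrite uk// leqNgt mk.
move=> [uk nu]; apply/eqP; rewrite eqn_leq uk leqNgt; apply/negP => ku.
by apply: nu; exists (scaled_trunc n u) => /=.
Qed.

Lemma preimage_vperm_of_real n (s : 'S_n.+1) :
  vperm_of_real @^-1` cylinder s =
  \bigcup_(k in [set k | fact_decode n k = s]) [set u | scaled_trunc n u = k].
Proof.
apply/seteqP; split=> u /=; first by move=> us; exists (scaled_trunc n u).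
by move=> [k /= <- <-].
Qed.

Lemma vperm_of_real_measurable :
  measurable_fun [set: measurableTypeR R] vperm_of_real.
Proof.
apply: (measurability (cylinders 0)); first exact: borel_cylinders.
move=> _ [_ [->|[n _ [s ->]]] <-]; rewrite setTI ?preimage_set0//.
rewrite preimage_vperm_of_real.
apply: (@bigcup_measurable _ (measurableTypeR R)) => k _.
exact: scaled_trunc_measurable.
Qed.

Definition unit_lebesgue : set (measurableTypeR R) -> \bar R :=
  mrestr (@lebesgue_measure R) (measurable_itv `[0, 1[%R).

HB.instance Definition _ := Measure.on unit_lebesgue.

Let unit_lebesgueT : unit_lebesgue setT = 1%E.
Proof.
by rewrite /unit_lebesgue /mrestr setTI lebesgue_measure_itv/= lte01 oppr0 adde0.
Qed.

HB.instance Definition _ :=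
  Measure_isProbability.Build _ _ _ unit_lebesgue unit_lebesgueT.

HB.instance Definition _ :=
  isMeasurableFun.Build _ _ _ _ vperm_of_real vperm_of_real_measurable.

Definition uniform_vperm : probability vperm_borel R :=
  distribution unit_lebesgue vperm_of_real.

(** Exactly one k below (n+1)! is the number of s, and the integer part of
    u (n+1)! is k precisely when u is in the k-th interval of length 1/(n+1)!. *)
Lemma uniform_vperm_cylinder n (s : 'S_n.+1) :
  uniform_vperm (cylinder s) = ((n.+1)`!%:R^-1)%:E.
Proof.
have [k kn ks] := fact_decode_surj s.
have f0 : (0 < ((n.+1)`!)%:R :> R)%R by rewrite ltr0n fact_gt0.
transitivity (lebesgue_measure
  `[(k%:R / (n.+1)`!%:R : R)%R, (k.+1%:R / (n.+1)`!%:R : R)%R[%classic).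
  rewrite /uniform_vperm /distribution /pushforward/= /unit_lebesgue /mrestr.
  congr lebesgue_measure; apply/seteqP; split=> u /=; rewrite !in_itv/=.
    move=> [us /andP[u0 u1]].
    have uf0 : (0 <= u * ((n.+1)`!)%:R)%R by rewrite mulr_ge0// ltW.
    rewrite ler_pdivrMr// ltr_pdivlMr//.
    have -> : k = scaled_trunc n u.
      apply: (@fact_decode_inj n) => //; last by rewrite ks.
      by rewrite truncn_lt_nat// gtr_pMl.
    exact: truncn_itv.
  rewrite ler_pdivrMr// ltr_pdivlMr// => uk; split.
    by rewrite /cylinder/= /vperm_val set_valE/= /scaled_trunc (truncn_def uk).
  case/andP: uk => ku uk; apply/andP; split.
    by rewrite -(pmulr_lge0 _ f0); apply: le_trans ku.
  by rewrite -(ltr_pM2r f0) mul1r (lt_le_trans uk)// ler_nat.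
rewrite lebesgue_measure_itv/= lte_fin ltr_pM2r ?invr_gt0// ltr_nat ltnSn.
by rewrite -EFinB -mulrBl -natrB// subSnn mul1r.
Qed.

End UniformVirtualPermutation.

Theorem proposition2p1p1 (R : realType) :
  exists mu : probability vperm_borel R,
    G_invariant mu /\
    forall nu : probability vperm_borel R, G_invariant nu ->
      forall A : set vperm_borel, measurable A -> nu A = mu A.
Proof.
exists (uniform_vperm R); split=> [|nu nuinv].
  exact/cylinder_G_invariant/uniform_vperm_cylinder.
apply: (@eq_probability_cylinder R 0) => n _ s.
by rewrite uniform_vperm_cylinder; exact: G_invariant_cylinder.
Qed.
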